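(* Let $r>0$ and let $A=(a,b)$ with $a,b>0$ be the coin-flipping game whose profit is $a$ if a tossed fair coin yields heads and $b$ if it yields tails. Put $E^{A}:=(a+b)/2$, and let $u_r^A$ denote the price of $A$ (with respect to the growth rate $e^r$). (1) If $E^{A}/\sqrt{ab}\le e^{r}$, then $u_r^A=\sqrt{ab}/e^{r}$, and the optimal proportion of investment (at price $u_r^A$) is $1$. (2) Otherwise, with $\kappa:=\bigl(1-\sqrt{1-1/e^{2r}}\bigr)/2$, one has $u_r^A=\kappa a+(1-\kappa)b$ if $a\ge b$, and $u_r^A=\kappa b+(1-\kappa)a$ if $a<b$; and the optimal proportion of investment (at price $u_r^A$) is $$\frac{u_r^A\,(E^{A}-u_r^A)}{(a-u_r^A)(u_r^A-b)}.$$
   Context: Growth rate. Let $A=(a,b)$, $a,b>0$, be a game offered at price $u>0$ per unit, and let $t\in[0,1]$ be a proportion of investment. The investor starts with capital $1$ and repeatedly invests the fraction $t$ of the current capital in independent plays of the game: if the current capital is $c$, then after one play it becomes $act/u+c(1-t)$ with probability $1/2$ (heads) and $bct/u+c(1-t)$ with probability $1/2$ (tails). Let $c_N$ be the capital after $N$ plays. The limit $\lim_{N\to\infty}\mathbb{E}\bigl[c_N^{1/N}\bigr]$ is a function of $t\in[0,1]$; its maximum over $t\in[0,1]$ is denoted $G_u^A$ (the limit expectation of the growth rate). Price and optimal proportion. For the risk-free continuously compounded interest rate $r>0$, the price $u_r^A$ is the value $u>0$ determined by the equation $G_u^A=e^{r}$. The optimal proportion of investment is the $t\in[0,1]$ at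 which the maximum $G_u^A$ is attained for $u=u_r^A$. *)

(* Defs.v *)
From HB Require Import structures.
From mathcomp Require Import all_boot all_order all_algebra finmap.
From mathcomp Require Import all_classical all_reals all_analysis.
Set Implicit Arguments.
Unset Strict Implicit.
Unset Printing Implicit Defensive.
Import Order.TTheory GRing.Theory Num.Theory.
Import numFieldNormedType.Exports.
Local Open Scope classical_set_scope.
Local Open Scope ring_scope.

Section CoinGame.
Context (d : measure_display) (T : measurableType d) (R : realType).
Context (P : probability T R).

Definition mutually_independent (X : nat -> {RV P >-> bool}) : Prop :=
  forall (J : {fset nat}) (B : nat -> set bool),
    P (\bigcap_(n in [set` J]) (X n @^-1` B n)) =
    (\prod_(n <- J) P (X n @^-1` B n))%E.

(* [toss n w = true] means that play number [n] yields heads. *)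
Definition fair_coin_tosses (toss : nat -> {RV P >-> bool}) : Prop :=
  (forall n, P (toss n @^-1` [set true]) = (2^-1)%:E) /\
  mutually_independent toss.

Variables (toss : nat -> {RV P >-> bool}) (a b : R).

Fixpoint capital (u t : R) (N : nat) (w : T) : R :=
  if N is n.+1 then
    let c := capital u t n w in
    (if toss n w then a else b) * c * t / u + c * (1 - t)
  else 1.

Definition mean_growth (u t : R) (N : nat) : \bar R :=
  'E_P[fun w => capital u t N w `^ (N%:R)^-1].

Definition is_growth_rate (u : R) (g : R -> R) : Prop :=
  forall t : R, 0 <= t <= 1 -> mean_growth u t @ \oo --> (g t)%:E.

(* The maximum of the growth rate over the unit interval is [G], and it is
   attained at [t].  The convergence of the expectations at every proportion
   is part of the assertion. *)
Definition max_growth_at (u G t : R) : Prop :=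
  exists2 g, is_growth_rate u g &
    [/\ 0 <= t <= 1, g t = G & forall s : R, 0 <= s <= 1 -> g s <= G].

Definition price_equation (r u : R) : Prop :=
  0 < u /\ exists t, max_growth_at u (expR r) t.

Definition is_price (r u : R) : Prop :=
  price_equation r u /\ forall v, price_equation r v -> v = u.

Definition is_optimal_proportion (u t : R) : Prop :=
  (exists G, max_growth_at u G t) /\
  forall s, (exists G, max_growth_at u G s) -> s = t.

End CoinGame.

(* Main.v *)
Require Import Defs.
From HB Require Import structures.
From mathcomp Require Import all_boot all_order all_algebra finmap.
From mathcomp Require Import all_classical all_reals all_analysis.
From mathcomp Require Import measurable_realfun ring lra.
Import Order.TTheory GRing.Theory Num.Theory.
Import numFieldNormedType.Exports.
Local Open Scope classical_set_scope.
Local Open Scope ring_scope.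

(* With p and q the factors applied to the capital on heads and tails,
   independence gives E[c_N^(1/N)] = ((p^(1/N) + q^(1/N)) / 2)^N, which tends to
   the geometric mean sqrt(p q).  The growth rate is thus governed by the quadratic
   p q in the proportion t, whose maximum is either at t = 1 or at an interior
   critical point, where p = 1/(2 kappa) and q = 1/(2 (1 - kappa)) (for b < a).
   For fixed t > 0 both factors decrease strictly with the price, so at most one
   price yields the growth e^r > 1. *)

(** * Limit of the n-th power of the mean of two n-th roots *)

Section Growth.
Context {R : realType}.
Implicit Types x y z : R.

Lemma bernoulli_inequality x n : -1 <= x -> 1 + n%:R * x <= (1 + x) ^+ n.
Proof.
move=> x_ge; elim: n => [|n IH]; first by rewrite mul0r addr0 expr0.
rewrite exprS -natr1; have n_ge0 : 0 <= n%:R :> R by [].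
apply: (@le_trans _ _ ((1 + x) * (1 + n%:R * x))); first by nra.
by rewrite ler_wpM2l//; lra.
Qed.

(* [expR x >= 1 + x] at [z] and [- z]. *)
Lemma mean_expR_le z : `|z| < 1 -> (expR z + expR (- z)) / 2 <= (1 - z ^+ 2)^-1.
Proof.
rewrite ltr_norml => /andP[zl zu].
have h1 : expR z <= (1 - z)^-1.
  rewrite -[expR z]invrK -expRN lef_pV2 ?posrE ?expR_gt0 ?expR_ge1Dx//; lra.
have h2 : expR (- z) <= (1 + z)^-1.
  rewrite expRN lef_pV2 ?posrE ?expR_gt0 ?expR_ge1Dx//; lra.
have -> : (1 - z ^+ 2)^-1 = ((1 - z)^-1 + (1 + z)^-1) / 2.
  by field; apply/and3P; split; apply/eqP; nra.
lra.
Qed.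

Lemma mean_expR_ge1 z : 1 <= (expR z + expR (- z)) / 2.
Proof. have := expR_ge1Dx z; have := expR_ge1Dx (- z); lra. Qed.

(* Dividing by the geometric mean leaves [cosh (D / n) ^+ n], which lies between
   [1] and [(1 - D ^+ 2 / n ^+ 2) ^- n <= (1 - D ^+ 2 / n)^-1]. *)
Lemma cvg_mean_root_expn x y : 0 < x -> 0 < y ->
  (((x `^ n%:R^-1 + y `^ n%:R^-1) / 2) ^+ n) @[n --> \oo] --> Num.sqrt (x * y).
Proof.
move=> x0 y0; set D := (ln x - ln y) / 2.
have sqrtE : Num.sqrt (x * y) = expR ((ln x + ln y) / 2).
  rewrite -[RHS]ger0_norm ?expR_ge0// -sqrtr_sqr -expRM_natl.
  by rewrite [2 * _]mulrC divfK ?pnatr_eq0// expRD !lnK ?posrE.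
(* The n-th roots of [x] and [y] are the n-th root of [Num.sqrt (x * y)] times [expR (D / n)] and
   [expR (- (D / n))], so [c n], their normalised mean, is cosh (D / n). *)
pose c n := (expR (D / n%:R) + expR (- (D / n%:R))) / 2.
have termE n : (0 < n)%N -> ((x `^ n%:R^-1 + y `^ n%:R^-1) / 2) ^+ n =
    Num.sqrt (x * y) * c n ^+ n.
  move=> n0; have n0' : n%:R != 0 :> R by rewrite pnatr_eq0 -lt0n.
  have -> : Num.sqrt (x * y) = expR ((ln x + ln y) / 2 / n%:R) ^+ n.
    by rewrite sqrtE -expRM_natr divfK.
  rewrite -exprMn /c mulrA mulrDr -!expRD /powR !gt_eqF//.
  by congr (((expR _ + expR _) / 2) ^+ n); rewrite /D; field.
pose m : R := D ^+ 2.
have cvgm : (m / n%:R) @[n --> \oo] --> (0 : R).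
  rewrite -(mulr0 m); apply: cvgMl_tmp.
  (* The harmonic sequence starts at 1 / (0 + 1), hence the shift by one. *)
  rewrite -(cvg_shiftS (fun n => n%:R^-1 : R)); exact: cvg_harmonic.
have : (Num.sqrt (x * y) * (1 - m / n%:R)^-1) @[n --> \oo] --> Num.sqrt (x * y).
  rewrite -[X in _ --> X]mulr1; apply: cvgMl_tmp.
  rewrite -[X in _ --> X]invr1; apply: cvgV; first exact: oner_neq0.
  by rewrite -[X in _ --> X]subr0; apply: cvgB => //; exact: cvg_cst.
apply: (squeeze_cvgr _ (@cvg_cst _ (Num.sqrt (x * y)) _ _ _)).
near=> n.
have n0 : (0 < n)%N by near: n; exact: nbhs_infty_gt.
have n0R : 0 < n%:R :> R by rewrite ltr0n.
have n1R : 1 <= n%:R :> R by rewrite ler1n.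
have nD : `|D| < n%:R by near: n; exact: nbhs_infty_gtr.
have nm : m < n%:R by near: n; exact: nbhs_infty_gtr.
rewrite termE//; apply/andP; split.
  by rewrite -[leLHS]mulr1 ler_wpM2l ?sqrtr_ge0// exprn_ege1// mean_expR_ge1.
rewrite ler_wpM2l ?sqrtr_ge0//.
have zlt : `|D / n%:R| < 1.
  by rewrite normrM normfV (gtr0_norm n0R) ltr_pdivrMr// mul1r.
have z2lt : (D / n%:R) ^+ 2 < 1.
  by rewrite -real_normK ?num_real// expr_lt1.
apply: (@le_trans _ _ ((1 - (D / n%:R) ^+ 2)^-1 ^+ n)).
  rewrite lerXn2r ?nnegrE ?mean_expR_le//.
    by apply: le_trans (mean_expR_ge1 _); exact: ler01.
  by rewrite invr_ge0; lra.
rewrite exprVn lef_pV2 ?posrE ?exprn_gt0//; [| lra | ].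
  have := @bernoulli_inequality (- (D / n%:R) ^+ 2) n.
  have -> : n%:R * - (D / n%:R) ^+ 2 = - (m / n%:R).
    by rewrite /m; field; rewrite gt_eqF.
  apply; lra.
by rewrite subr_gt0 ltr_pdivrMr ?mul1r.
Unshelve. all: by end_near.
Qed.

End Growth.

(** * The quadratic in the proportion: monotonicity in the price and maximisers *)

Section Payoff.
Context {R : realType}.
Implicit Types a b r s t u v x : R.

Definition payoff x u t := x * t / u + (1 - t).

Definition payoff_prod a b u t := payoff a u t * payoff b u t.

Lemma payoff_gt0 x u t : 0 < x -> 0 < u -> 0 <= t <= 1 -> 0 < payoff x u t.
Proof.
move=> x0 u0 /andP[t0 t1]; rewrite /payoff mulrAC.
have xu : 0 < x / u by rewrite divr_gt0.
have := mulr_ge0 (ltW xu) t0; case: (ltrP t 1) => ? ?; first lra.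
have -> : t = 1 by lra.
lra.
Qed.

Lemma payoff_prodC a b u t : payoff_prod a b u t = payoff_prod b a u t.
Proof. exact: mulrC. Qed.

Lemma payoff_lt x u v t : 0 < x -> 0 < u -> u < v -> 0 < t ->
  payoff x v t < payoff x u t.
Proof.
move=> x0 u0 uv t0; rewrite /payoff ltrD2r ltr_pM2l ?mulr_gt0//.
by rewrite ltf_pV2 ?posrE//; exact: lt_trans uv.
Qed.

Lemma payoff_prod_lt a b u v t : 0 < a -> 0 < b -> 0 < u -> u < v ->
  0 < t <= 1 -> payoff_prod a b v t < payoff_prod a b u t.
Proof.
move=> a0 b0 u0 uv /andP[t0 t1]; have v0 := lt_trans u0 uv.
have t01 : 0 <= t <= 1 by rewrite ltW.
by apply: ltr_pM; rewrite ?ltW ?payoff_gt0 ?payoff_lt.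
Qed.

(** The gap to the value at 1 is (1 - t) / u^2 times a convex combination of a b - u^2 and 2 (a b -
    u (a + b) / 2), where the first, positive term has weight 1 - t > 0. The hypotheses say that the
    value at 1 exceeds the value at 0 and that the slope at 1 is nonnegative. *)
Lemma payoff_prod1_max a b u t : 0 < a -> 0 < b -> 0 < u ->
  u ^+ 2 < a * b -> (a + b) / 2 * u <= a * b -> 0 <= t < 1 ->
  payoff_prod a b u t < payoff_prod a b u 1.
Proof.
move=> a0 b0 u0 abu Eu /andP[t0 t1]; rewrite -subr_gt0.
have -> : payoff_prod a b u 1 - payoff_prod a b u t =
    (1 - t) / u ^+ 2 * ((1 - t) * (a * b - u ^+ 2)
                        + t * (2 * (a * b - (a + b) / 2 * u))).
  by rewrite /payoff_prod /payoff; field; rewrite gt_eqF.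
rewrite mulr_gt0 ?divr_gt0 ?exprn_gt0 ?subr_gt0//.
by rewrite ltr_wpDr ?mulr_gt0 ?mulr_ge0 ?subr_gt0 ?subr_ge0.
Qed.

(** The critical point in [t] of the quadratic [payoff_prod a b u t]. *)
Definition interior_proportion a b u :=
  u * ((a + b) / 2 - u) / ((a - u) * (u - b)).

Lemma interior_proportionC a b u :
  interior_proportion a b u = interior_proportion b a u.
Proof.
rewrite /interior_proportion [a + b]addrC.
by have -> : (a - u) * (u - b) = (b - u) * (u - a) by ring.
Qed.

(** Completing the square: the leading coefficient - (a - u) (u - b) / u^2 is negative, so the
    vertex is the strict maximum. *)
Lemma payoff_prod_interior_max a b u t : 0 < u -> 0 < (a - u) * (u - b) ->
  t != interior_proportion a b u ->
  payoff_prod a b u t < payoff_prod a b u (interior_proportion a b u).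
Proof.
move=> u0 k0 tneq; rewrite -subr_gt0.
have : (a - u) * (u - b) != 0 by rewrite gt_eqF.
rewrite mulf_eq0 negb_or => /andP[au ub].
have -> : payoff_prod a b u (interior_proportion a b u) - payoff_prod a b u t =
    (t - interior_proportion a b u) ^+ 2 * ((a - u) * (u - b) / u ^+ 2).
  rewrite /payoff_prod /payoff /interior_proportion; field.
  by rewrite ub au gt_eqF.
by rewrite mulr_gt0 ?exprn_even_gt0 ?subr_eq0//= divr_gt0 ?exprn_gt0.
Qed.

(** For r > 0, the smaller root k of 4 k (1 - k) = exp (- 2 r). *)
Definition kappa r : R := (1 - Num.sqrt (1 - 1 / expR (2 * r))) / 2.

Lemma kappa_bounds r : 0 < r -> 0 < kappa r < 1 / 2.
Proof.
move=> r0; rewrite /kappa.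
have e1 : 1 < expR (2 * r) by rewrite expR_gt1; lra.
have e0 : 0 < 1 / expR (2 * r) by rewrite div1r invr_gt0 expR_gt0.
have e2 : 1 / expR (2 * r) < 1 by rewrite ltr_pdivrMr ?expR_gt0// mul1r.
have : 0 < Num.sqrt (1 - 1 / expR (2 * r)) by rewrite sqrtr_gt0; lra.
have : Num.sqrt (1 - 1 / expR (2 * r)) < 1.
  by rewrite -[ltRHS]sqrtr1 ltr_sqrt; lra.
by move=> ? ?; apply/andP; split; lra.
Qed.

Lemma kappaM r : 0 < r -> expR r ^+ 2 = (4 * (kappa r * (1 - kappa r)))^-1.
Proof.
move=> r0; rewrite /kappa; set s := Num.sqrt _.
have e1 : 1 < expR (2 * r) by rewrite expR_gt1; lra.
have : s ^+ 2 = 1 - 1 / expR (2 * r).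
  by rewrite sqr_sqrtr// subr_ge0 ler_pdivrMr ?expR_gt0// mul1r ltW.
have -> : 4 * ((1 - s) / 2 * (1 - (1 - s) / 2)) = 1 - s ^+ 2 by field.
by move=> ->; rewrite opprB addrC subrK div1r invrK expRM_natl.
Qed.

(** The price divides the segment from [b] to [a] in the ratio k : 1 - k, which makes the factors at
    the vertex 1 / (2 k) and 1 / (2 (1 - k)), with product 1 / (4 k (1 - k)). *)
Lemma interior_price_spec a b r (u := kappa r * a + (1 - kappa r) * b) :
  0 < r -> 0 < b -> b < a -> expR r ^+ 2 * (4 * (a * b)) < (a + b) ^+ 2 ->
  [/\ 0 < u, 0 < (a - u) * (u - b), 0 <= interior_proportion a b u <= 1 &
      payoff_prod a b u (interior_proportion a b u) = expR r ^+ 2].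
Proof.
move=> r0 b0 ba; have /andP[k0 k2] := kappa_bounds _ r0.
rewrite kappaM//; move: k0 k2 @u; move: (kappa r) => k k0 k2 u.
have u0 : 0 < u by rewrite /u; nra.
have aub : 0 < a - b by lra.
have k1 : 0 < 1 - k by lra.
have auE : a - u = (1 - k) * (a - b) by rewrite /u; ring.
have ubE : u - b = k * (a - b) by rewrite /u; ring.
have kk0 : 0 < k * (1 - k) by nra.
move=> H; have {}H : a * b < k * (1 - k) * (a + b) ^+ 2.
  by move: H; rewrite [_^-1 * _]mulrC ltr_pdivrMr; lra.
have tE : interior_proportion a b u = u * (1 - 2 * k) / (2 * k * (1 - k) * (a - b)).
  rewrite /interior_proportion auE ubE /u; field.
  by rewrite !gt_eqF.
split=> //.
- by rewrite auE ubE; do ! apply: mulr_gt0.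
- have den0 : 0 < 2 * k * (1 - k) * (a - b) by do ! apply: mulr_gt0.
  rewrite tE; apply/andP; split.
    by rewrite ltW// divr_gt0//; apply: mulr_gt0 => //; lra.
  rewrite ler_pdivrMr// mul1r /u.
  (* The product in [F] expands to k (1 - k) (a + b)^2 - a b, positive by hypothesis. Its second
     factor is positive, hence so is k a - (1 - k) b, which is exactly the slack in the bound of the
     proportion by 1. *)
  have F : 0 < (k * a - (1 - k) * b) * ((1 - k) * a - k * b) by nra.
  have F2 : 0 < (1 - k) * a - k * b by nra.
  move: F; rewrite pmulr_lgt0// => F; nra.
- rewrite /payoff_prod /payoff tE /u; field.
  by rewrite !gt_eqF.
Qed.

End Payoff.

(** * Expectation of a product over independent tosses *)

Section Independence.
Context (d : measure_display) (T : measurableType d) (R : realType).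
Context (P : probability T R) (toss : nat -> {RV P >-> bool}).
Context (htoss : fair_coin_tosses toss).
Implicit Types (x y : R) (J : {fset nat}) (B : nat -> set bool).

Let cylinder J B : set T := \bigcap_(n in [set` J]) (toss n @^-1` B n).

Lemma measurable_toss n (A : set bool) : measurable (toss n @^-1` A).
Proof. by rewrite -[X in measurable X]setTI; exact: measurable_funPT. Qed.

Lemma toss_prob n c : P (toss n @^-1` [set c]) = (2^-1)%:E.
Proof.
case: c; first exact: htoss.1.
have -> : toss n @^-1` [set false] = ~` (toss n @^-1` [set true]).
  by apply/seteqP; split => w /=; case: (toss n w).
rewrite probability_setC; last exact: measurable_toss.
rewrite [X in (1 - X)%E]htoss.1 -EFinB; congr EFin; lra.
Qed.

Let measurable_cylinder J B : measurable (cylinder J B).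
Proof.
by apply: fin_bigcap_measurable => // n _; exact: measurable_toss.
Qed.

Lemma measurable_toss_prod x y n :
  measurable_fun setT (fun w => \prod_(i < n) (if toss i w then x else y)).
Proof.
apply: measurable_prod => i _; exact: measurable_fun_ifT.
Qed.

(* Integrating over cylinders on later tosses makes the induction close: each
   half of [cylinder J B] cut by toss [n] is again such a cylinder. *)
Lemma integral_toss_prod_cylinder x y n J B : 0 <= x -> 0 <= y ->
  (forall j, j \in J -> (n <= j)%N) ->
  (\int[P]_(w in cylinder J B) (\prod_(i < n) (if toss i w then x else y))%:E =
   (((x + y) / 2) ^+ n)%:E * \prod_(j <- J) P (toss j @^-1` B j))%E.
Proof.
move=> x0 y0; elim: n J B => [|n IH] J B Jn.
  under eq_integral do rewrite big_ord0.
  by rewrite integral_cst// expr0 -htoss.2.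
pose f w := (\prod_(i < n) (if toss i w then x else y))%:E.
have f0 w : (0 <= f w)%E.
  by rewrite lee_fin prodr_ge0// => i _; case: ifP.
have mf D : measurable_fun D f.
  by apply: measurable_funTS; apply/measurable_EFinP; exact: measurable_toss_prod.
pose half c := cylinder J B `&` toss n @^-1` [set c].
have mhalf c : measurable (half c).
  by apply: measurableI => //; exact: measurable_toss.
have nJ : n \notin J by apply/negP => /Jn; rewrite ltnn.
have halfE c : (\int[P]_(w in half c) f w =
    (((x + y) / 2) ^+ n)%:E * ((2^-1)%:E * \prod_(j <- J) P (toss j @^-1` B j)))%E.
  (* As [n] is not in [J], fixing the outcome of toss [n] only adds one index to the cylinder, and
     the induction hypothesis applies to it. *)
  pose B' j := if j == n then [set c] else B j.
  have neq j : j \in J -> (j == n) = false.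
    by move=> jJ; apply/negbTE; apply: contraNneq nJ => <-.
  have -> : half c = cylinder (n |` J)%fset B'.
    apply/seteqP; split => w /=.
      move=> [cw tw] j /=; rewrite !inE => /orP[/eqP->|jJ].
        by rewrite /B' eqxx.
      by rewrite /B' neq//; exact: cw.
    move=> H; split; last first.
      by have := H n; rewrite /= /B' eqxx; apply; rewrite !inE eqxx.
    move=> j /= jJ; have := H j; rewrite /= /B' neq//; apply.
    by rewrite !inE jJ orbT.
  rewrite IH; last by move=> j; rewrite !inE => /orP[/eqP->//|/Jn/ltnW].
  rewrite big_fsetU1//=; congr (_ * (_ * _))%E.
    by rewrite /B' eqxx toss_prob.
  by apply: eq_big_seq => j jJ; rewrite /B' neq.
have cylE : cylinder J B = half true `|` half false.
  apply/seteqP; split => w.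
    by move=> cw; case E : (toss n w); [left|right].
  by case=> -[].
have scale c (k := if c then x else y) :
    (\int[P]_(w in half c) (\prod_(i < n.+1) (if toss i w then x else y))%:E =
     k%:E * \int[P]_(w in half c) f w)%E.
  rewrite -ge0_integralZl_EFin//; last by rewrite /k; case: (c).
  apply: eq_integral => w; rewrite inE => -[_ /= tw].
  by rewrite big_ord_recr/= tw mulrC EFinM.
rewrite cylE ge0_integral_setU//.
- rewrite !scale !halfE; set q := (\prod_(j <- J) _)%E.
  have m_ge0 : 0 <= ((x + y) / 2) ^+ n by rewrite exprn_ge0// divr_ge0// addr_ge0.
  rewrite !muleA -!EFinM -ge0_muleDl ?lee_fin ?mulr_ge0//.
  by rewrite -EFinD; congr (_%:E * _)%E; rewrite exprSr; field.
- by apply: measurable_funTS; apply/measurable_EFinP; exact: measurable_toss_prod.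
- by move=> w _; rewrite lee_fin prodr_ge0// => i _; case: ifP.
- by apply/disj_setPS => w [[_ /= tw] [_ /=]]; rewrite tw.
Qed.

Lemma expectation_toss_prod x y n : 0 <= x -> 0 <= y ->
  expectation P (fun w => \prod_(i < n) (if toss i w then x else y)) =
  (((x + y) / 2) ^+ n)%:E.
Proof.
move=> x0 y0; rewrite unlock.
(* The cylinder over no index is the whole space. *)
have := @integral_toss_prod_cylinder x y n fset0 (fun=> setT) x0 y0.
rewrite /cylinder set_fset0 bigcap_set0 big_seq_fset0 mule1; exact.
Qed.

(** * Growth rate, price and optimal proportion of the game *)

Context (a b : R) (a0 : 0 < a) (b0 : 0 < b).

Lemma capital_prod u t n w : capital toss a b u t n w =
  \prod_(i < n) (if toss i w then payoff a u t else payoff b u t).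
Proof.
elim: n => [|n IH] /=; first by rewrite big_ord0.
by rewrite big_ord_recr/= -IH /payoff; case: ifP => _; ring.
Qed.

Lemma mean_growthE u t n : 0 < u -> 0 <= t <= 1 -> mean_growth toss a b u t n =
  (((payoff a u t `^ n%:R^-1 + payoff b u t `^ n%:R^-1) / 2) ^+ n)%:E.
Proof.
move=> u0 t01; rewrite /mean_growth -expectation_toss_prod ?powR_ge0//.
(* The exponent is generalised so that it stays fixed while the number of plays varies in the
   induction. *)
congr expectation; apply/funext => w; rewrite capital_prod; move: n%:R^-1 => s.
have pay_ge0 i :
    0 <= (if toss i w then payoff a u t else payoff b u t).
  by case: ifP => _; rewrite ltW// payoff_gt0.
elim: n => [|n IH]; first by rewrite !big_ord0 powR1.
rewrite !big_ord_recr/= powRM ?prodr_ge0// IH.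
by case: ifP.
Qed.

Lemma sqrt_payoff_prod_growth_rate u : 0 < u ->
  is_growth_rate toss a b u (fun t => Num.sqrt (payoff_prod a b u t)).
Proof.
move=> u0 t t01.
under eq_cvg do rewrite mean_growthE//.
apply: cvg_EFin; first exact: nearW.
by apply: cvg_mean_root_expn; exact: payoff_gt0.
Qed.

(** Limits are unique, so every admissible growth rate agrees with the square root on the unit
    interval; monotonicity of the root then reduces maximality to the quadratic. *)
Lemma max_growth_atP u G t : 0 < u ->
  max_growth_at toss a b u G t <->
  [/\ 0 <= t <= 1, Num.sqrt (payoff_prod a b u t) = G &
      forall s, 0 <= s <= 1 -> payoff_prod a b u s <= payoff_prod a b u t].
Proof.
move=> u0; have h_gt0 s : 0 <= s <= 1 -> 0 < payoff_prod a b u s.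
  by move=> s01; rewrite mulr_gt0// payoff_gt0.
split=> [[g gP [t01 gt gmax]]|[t01 tG tmax]].
  have gE s : 0 <= s <= 1 -> g s = Num.sqrt (payoff_prod a b u s).
    move=> s01; apply: EFin_inj; apply: cvg_unique (gP s s01) _.
      exact: ereal_hausdorff.
    exact: sqrt_payoff_prod_growth_rate.
  split=> [//||s s01]; first by rewrite -gE.
  by rewrite -(ler_sqrt _ (ltW (h_gt0 t t01))) -!gE// gt gmax.
exists (fun s => Num.sqrt (payoff_prod a b u s)).
  exact: sqrt_payoff_prod_growth_rate.
by split=> // s s01; rewrite -tG (ler_sqrt _ (ltW (h_gt0 t t01))) tmax.
Qed.

Lemma strict_max_price_proportion r u t : 0 < r -> 0 < u -> 0 <= t <= 1 ->
  payoff_prod a b u t = expR r ^+ 2 ->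
  (forall s, 0 <= s <= 1 -> s != t ->
     payoff_prod a b u s < payoff_prod a b u t) ->
  is_price toss a b r u /\ is_optimal_proportion toss a b u t.
Proof.
move=> r0 u0 t01 tE smax.
have wmax s : 0 <= s <= 1 -> payoff_prod a b u s <= payoff_prod a b u t.
  by move=> s01; have [->//|st] := eqVneq s t; rewrite ltW ?smax.
have optimal : max_growth_at toss a b u (expR r) t.
  apply/max_growth_atP => //; split=> //.
  by rewrite tE sqrtr_sqr ger0_norm ?expR_ge0.
(* At proportion 0 the product is 1 < exp (2 r), so a proportion reaching exp (2 r) is positive, as
   strict monotonicity in the price requires. *)
have pos v s : 0 <= s <= 1 -> payoff_prod a b v s = expR r ^+ 2 -> 0 < s <= 1.
  move=> /andP[s0 ->]; rewrite andbT lt_neqAle s0 andbT.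
  apply: contra_eqN => /eqP <-.
  rewrite /payoff_prod /payoff !mulr0 !mul0r subr0 add0r mulr1.
  by rewrite lt_eqF// exprn_egt1// expR_gt1.
split; split; [by split=> //; exists t | | by exists (expR r) | ].
- move=> v [v0 [s /max_growth_atP-/(_ v0)[s01 sG s_max]]].
  have sE : payoff_prod a b v s = expR r ^+ 2.
    by rewrite -sG sqr_sqrtr// ltW// mulr_gt0// payoff_gt0.
  (* At the lower of two distinct prices, the maximiser of the higher one would give more than exp
     (2 r), which is the maximum at both. *)
  case: (ltgtP v u) => // [vu|uv].
    have := payoff_prod_lt a b v u t a0 b0 v0 vu (pos _ _ t01 tE).
    by rewrite tE -sE ltNge s_max.
  have := payoff_prod_lt a b u v s a0 b0 u0 uv (pos _ _ s01 sE).
  by rewrite sE -tE ltNge wmax.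
- move=> s [G /max_growth_atP-/(_ u0)[s01 _ s_max]].
  apply/eqP/negP => /negP/(smax _ s01).
  by rewrite ltNge s_max.
Qed.

End Independence.

Theorem theorem1p1 (d : measure_display) (T : measurableType d) (R : realType)
    (P : probability T R) (toss : nat -> {RV P >-> bool})
    (htoss : fair_coin_tosses toss)
    (r a b : R) (hr : 0 < r) (ha : 0 < a) (hb : 0 < b) :
  let E := (a + b) / 2 in
  (E / Num.sqrt (a * b) <= expR r ->
     let u := Num.sqrt (a * b) / expR r in
     is_price toss a b r u /\ is_optimal_proportion toss a b u 1) /\
  (~ (E / Num.sqrt (a * b) <= expR r) ->
     let kappa := (1 - Num.sqrt (1 - 1 / expR (2 * r))) / 2 in
     let u := if b <= a then kappa * a + (1 - kappa) * b
              else kappa * b + (1 - kappa) * a in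
     is_price toss a b r u /\
     is_optimal_proportion toss a b u
       (u * (E - u) / ((a - u) * (u - b)))).
Proof.
move=> E.
have ab0 : 0 < a * b by rewrite mulr_gt0.
have sab0 : 0 < Num.sqrt (a * b) by rewrite sqrtr_gt0.
have sabE : Num.sqrt (a * b) ^+ 2 = a * b by rewrite sqr_sqrtr// ltW.
have er1 : 1 < expR r by rewrite expR_gt1.
split=> [Er u|/negP].
  have u0 : 0 < u by rewrite divr_gt0 ?expR_gt0.
  have ueE : u * expR r = Num.sqrt (a * b) by rewrite /u divfK// gt_eqF// expR_gt0.
  have abE : a * b = u ^+ 2 * expR r ^+ 2 by rewrite -sabE -ueE exprMn.
  apply: strict_max_price_proportion => //; rewrite ?ler01 ?lexx//.
    rewrite /payoff_prod /payoff subrr !addr0 !mulr1 mulf_div abE.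
    by field; rewrite gt_eqF.
  move=> s /andP[s0 s1] sn1; apply: payoff_prod1_max => //.
  - by rewrite abE ltr_pMr ?exprn_gt0// exprn_egt1.
  (* Since a b = exp r * sqrt (a b) * u, the slope condition is the case hypothesis multiplied by
     sqrt (a b) * u. *)
  - have -> : a * b = expR r * (u * expR r) * u by rewrite abE; ring.
    by rewrite ler_pM2r// ueE -ler_pdivrMr.
  - by rewrite s0 lt_neqAle sn1.
rewrite -ltNge ltr_pdivlMr// => Er k.
have Er2 : expR r ^+ 2 * (4 * (a * b)) < (a + b) ^+ 2.
  have : (expR r * Num.sqrt (a * b)) ^+ 2 < ((a + b) / 2) ^+ 2.
    by rewrite ltrXn2r// nnegrE ?mulr_ge0 ?divr_ge0 ?addr_ge0// ltW.
  by rewrite exprMn sabE; lra.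
(* For a = b the ratio of the means is 1 < exp r, which belongs to the other case. *)
have anb : a != b.
  apply/eqP => ab; have er2 : 1 < expR r ^+ 2 by rewrite exprn_egt1.
  move: Er2; have := ltr_pM2r ab0 1 (expR r ^+ 2); rewrite er2 ab; lra.
case: (ltgtP b a) anb => // [ba|ab] _ u.
  rewrite -/(interior_proportion a b u).
  have [u0 k0 t01 tE] := interior_price_spec a b r hr hb ba Er2.
  apply: strict_max_price_proportion => // s _ st.
  exact: payoff_prod_interior_max.
(* For a < b the roles of [a] and [b] are exchanged; the quadratic and its vertex are symmetric in
   them. *)
have Er2' : expR r ^+ 2 * (4 * (b * a)) < (b + a) ^+ 2.
  by rewrite [b * a]mulrC [b + a]addrC.
have [u0 k0 t01 tE] := interior_price_spec b a r hr ha ab Er2'.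
rewrite -/(interior_proportion a b u) interior_proportionC.
apply: strict_max_price_proportion => //; first by rewrite payoff_prodC.
move=> s _ st; rewrite ![payoff_prod a b _ _]payoff_prodC.
exact: payoff_prod_interior_max.
Qed.
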